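(* There is an absolute constant $c>0$ such that for every prime $p\geq 3$ there is a set $A\subseteq\mathbb{Z}/p\mathbb{Z}$ with $|A|=\lfloor p/2\rfloor$ and \[ \big||A\cap(A+x)|-p/4\big| \;\geq\; \frac{c\,p}{\log p\,\log\log p}\qquad\text{for all } x\in\mathbb{Z}/p\mathbb{Z}. \]
   Context: $A+x:=\{a+x:a\in A\}$. *)

(* Defs.v *)
From mathcomp Require Import all_boot all_order all_algebra.
Set Implicit Arguments.
Unset Strict Implicit.
Unset Printing Implicit Defensive.
Import GRing.Theory.
Local Open Scope ring_scope.

Definition translate (G : finZmodType) (A : {set G}) (x : G) : {set G} :=
  [set a + x | a in A].

(* Main.v *)
Require Import Defs.
From mathcomp Require Import all_boot all_order all_algebra.
From mathcomp Require Import boolp reals topology normedtype derive sequences exp trigo.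
From mathcomp Require Import ring lra zify.
Set Implicit Arguments.
Unset Strict Implicit.
Unset Printing Implicit Defensive.
Import Order.TTheory GRing.Theory Num.Theory.
Local Open Scope ring_scope.

(** Write p = 2m + 1. The even function x |-> sum_k cos(2 pi k x / p) / cos(pi k / p),
    over 0 < k <= m with k = m mod 2, alternates in sign and has modulus at least m / 2
    at every x: two consecutive values add up to a Dirichlet kernel. As its coefficients
    are positive, it is (twice) the autocorrelation of the odd function
    f = sum_k +-b_k sin(2 pi k y / p) with b_k^2 = 1 / (p cos(pi k / p)), for any signs.
    Since sum_k b_k^2 = O(log p), random signs make f subgaussian at scale sqrt(log p),
    so cutting f at height M = O(sqrt(log p loglog p)) barely changes its autocorrelation.
    Dividing by M and rounding independently to +-1 gives a set whose autocorrelation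
    is that of f / M up to an error controlled by a martingale along the orbit
    0, x, 2x, ..., which visits all residues because p is prime. Finally the size is
    corrected. For bounded p it suffices that p is odd. *)


(** * Independent random signs with prescribed means, and their exponential moments *)

Section ProductMeasure.
Variables (R : realType) (T : finType) (f : T -> R).
Hypothesis f_le1 : forall y, `|f y| <= 1.

Definition sgb (b : bool) : R := if b then 1 else -1.

(** The law of a random sign with mean [f y]. *)
Definition coin (y : T) (b : bool) : R := (1 + sgb b * f y) / 2.

Definition weight (s : {ffun T -> bool}) : R := \prod_y coin y (s y).

Definition Ex (F : {ffun T -> bool} -> R) : R := \sum_s weight s * F s.

Definition upd (s : {ffun T -> bool}) (y : T) (b : bool) : {ffun T -> bool} :=
  [ffun z => if z == y then b else s z].

Lemma norm_sgb b : `|sgb b| = 1.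
Proof. by case: b; rewrite /sgb ?normrN normr1. Qed.

Lemma coin_ge0 y b : 0 <= coin y b.
Proof.
have := f_le1 y; rewrite ler_norml /coin /sgb => /andP[h1 h2].
by case: b; lra.
Qed.

Lemma sum_coin y : \sum_b coin y b = 1.
Proof. by rewrite big_bool /= /coin /sgb; field. Qed.

Lemma weight_ge0 s : 0 <= weight s.
Proof. by apply: prodr_ge0 => y _; exact: coin_ge0. Qed.

Lemma sum_weight : \sum_s weight s = 1.
Proof.
rewrite /weight -(bigA_distr_bigA (fun y b => coin y b)).
by apply: big1 => y _; rewrite sum_coin.
Qed.

Lemma Ex_le F G : (forall s, F s <= G s) -> Ex F <= Ex G.
Proof. by move=> FG; apply: ler_sum => s _; rewrite ler_wpM2l ?weight_ge0. Qed.

Lemma Ex_mulr F a : Ex (fun s => F s * a) = Ex F * a.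
Proof. by rewrite /Ex mulr_suml; apply: eq_bigr => s _; rewrite mulrA. Qed.

Lemma Ex_sum (I : Type) (r : seq I) (F : I -> {ffun T -> bool} -> R) :
  Ex (fun s => \sum_(i <- r) F i s) = \sum_(i <- r) Ex (F i).
Proof.
rewrite /Ex exchange_big; apply: eq_bigr => s _; by rewrite mulr_sumr.
Qed.

Lemma Ex_cst a : Ex (fun=> a) = a.
Proof. by rewrite /Ex -mulr_suml sum_weight mul1r. Qed.

Lemma Ex_exists F a : Ex F <= a -> exists s, F s <= a.
Proof.
move=> FA; apply/existsP; apply: contraT; rewrite negb_exists => /forallP Fa.
suff: a < Ex F by rewrite ltNge FA.
have {Fa}Fa s : 0 < F s - a by rewrite subr_gt0 ltNge Fa.
have [s ws]: exists s, 0 < weight s.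
  apply/existsP; apply: contraT; rewrite negb_exists => /forallP w0.
  have /eqP := sum_weight; rewrite big1 ?(eq_sym 0) ?oner_eq0 // => s _.
  by apply/eqP; rewrite eq_le weight_ge0 andbT leNgt w0.
rewrite -[a]Ex_cst -subr_gt0 /Ex -sumrB (bigD1 s) //=.
apply: ltr_wpDr; last by rewrite -mulrBr mulr_gt0.
by apply: sumr_ge0 => t _; rewrite -mulrBr mulr_ge0 ?weight_ge0 ?ltW.
Qed.

Lemma weight_upd s y b : weight (upd s y b) * coin y (s y) = weight s * coin y b.
Proof.
rewrite /weight (bigD1 y) //= [X in _ = X * _](bigD1 y) //= ffunE eqxx.
rewrite (eq_bigr (fun z => coin z (s z))); first by ring.
by move=> z /negPf zy; rewrite ffunE zy.
Qed.

Lemma updK s y b : upd (upd s y b) y (s y) = s.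
Proof. by apply/ffunP => z; rewrite !ffunE; case: eqP => // ->. Qed.

(** Redrawing one coordinate from its own law does not change the expectation; the inner sum is the
    conditional expectation given all the other coordinates. *)
Lemma Ex_resample y F : Ex F = Ex (fun s => \sum_b coin y b * F (upd s y b)).
Proof.
(* Swapping the stored bit with the fresh one is an involution that preserves the joint weight, by
   [weight_upd]. *)
pose flip (u : {ffun T -> bool} * bool) := (upd u.1 y u.2, u.1 y).
have flipK : involutive flip.
  by case=> s b; rewrite /flip /= updK !ffunE eqxx.
rewrite /Ex.
under [RHS]eq_bigr do rewrite mulr_sumr.
rewrite pair_big /= (reindex_inj (inv_inj flipK)) /=.
under [RHS]eq_bigr => u _ do rewrite mulrA weight_upd updK.
rewrite -(pair_bigA _ (fun s b => weight s * coin y b * F s)) /=.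
apply: eq_bigr => s _.
by rewrite -mulr_suml -mulr_sumr sum_coin mulr1.
Qed.

(** Follows from [expR u <= (1 - u)^-1], which is [1 - u <= expR (- u)] inverted. *)
Lemma expR_le_quadratic (u : R) : `|u| <= 1 / 2 -> expR u <= 1 + u + 2 * u ^+ 2.
Proof.
rewrite ler_norml => /andP[u1 u2].
have e1 : 1 - u <= expR (- u) by exact: expR_ge1Dx.
have u0 : 0 < 1 - u by lra.
rewrite -[expR u]opprK -[u in expR u]opprK expRN opprK.
apply: (@le_trans _ _ (1 - u)^-1).
  by rewrite lef_pV2 ?posrE ?expR_gt0.
rewrite -[leLHS]mul1r ler_pdivrMr //.
have : 0 <= u ^+ 2 * (1 - 2 * u) by rewrite mulr_ge0 ?sqr_ge0 //; lra.
by rewrite !expr2; nra.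
Qed.

(** In the quadratic bound the linear term averages to 0 and the variance is [1 - f y ^+ 2], at most
    1. *)
Lemma coin_mgf y (c : R) : `|c| <= 1 / 4 ->
  \sum_b coin y b * expR ((sgb b - f y) * c) <= expR (8 * c ^+ 2).
Proof.
move=> c4; have := f_le1 y; rewrite ler_norml => /andP[h1 h2].
have eb b : `|sgb b - f y| <= 2.
  by rewrite ler_norml; case: b; rewrite /sgb; lra.
have e b : expR ((sgb b - f y) * c) <=
    1 + (sgb b - f y) * c + 2 * ((sgb b - f y) * c) ^+ 2.
  apply: expR_le_quadratic; rewrite normrM.
  have -> : (1 / 2 : R) = 2 * (1 / 4) by field.
  by apply: ler_pM.
apply: (@le_trans _ _ (\sum_b coin y b *
    (1 + (sgb b - f y) * c + 2 * ((sgb b - f y) * c) ^+ 2))).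
  by apply: ler_sum => b _; rewrite ler_wpM2l ?coin_ge0.
apply: le_trans (expR_ge1Dx _).
rewrite big_bool /= /coin /sgb.
have : 0 <= c ^+ 2 * (3 + f y ^+ 2) by rewrite mulr_ge0 ?sqr_ge0 // addr_ge0 ?sqr_ge0.
rewrite !expr2; nra.
Qed.

Definition noise (s : {ffun T -> bool}) (y : T) : R := sgb (s y) - f y.

Lemma noise_upd s y b z : z != y -> noise (upd s y b) z = noise s z.
Proof. by move=> /negPf zy; rewrite /noise ffunE zy. Qed.

(** An Azuma-type bound. Resampling the last coordinate [y n] touches neither the earlier terms nor
    any coefficient, so the last factor averages out by [coin_mgf] and induction applies. *)
Lemma martingale_mgf (n : nat) (y : nat -> T)
    (c : nat -> {ffun T -> bool} -> R) (B : nat -> R) :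
  (forall i j, (i < j < n)%N -> y i != y j) ->
  (forall i j s b, (j <= i < n)%N -> c j (upd s (y i) b) = c j s) ->
  (forall j s, (j < n)%N -> `|c j s| <= B j) ->
  (forall j, (j < n)%N -> B j <= 1 / 4) ->
  Ex (fun s => expR (\sum_(j < n) noise s (y j) * c j s))
    <= expR (\sum_(j < n) 8 * B j ^+ 2).
Proof.
elim: n => [|n IH] yinj cind cB B4.
  by under [fun s => _]boolp.funext do rewrite big_ord0 expR0; rewrite big_ord0 expR0 Ex_cst.
rewrite (Ex_resample (y n)).
apply: (@le_trans _ _ (Ex (fun s => expR (\sum_(j < n) noise s (y j) * c j s)
   * expR (8 * B n ^+ 2)))).
  apply: Ex_le => s.
  have -> : \sum_b coin (y n) b * expR (\sum_(j < n.+1)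
      noise (upd s (y n) b) (y j) * c j (upd s (y n) b)) =
    expR (\sum_(j < n) noise s (y j) * c j s) *
      \sum_b coin (y n) b * expR ((sgb b - f (y n)) * c n s).
    rewrite mulr_sumr; apply: eq_bigr => b _.
    rewrite big_ord_recr /= expRD [RHS]mulrCA; congr (_ * (_ * _)).
      congr expR; apply: eq_bigr => j _.
      by rewrite noise_upd ?cind // ?yinj // ?ltnS ?ltn_ord ?leqnn ?andbT // ltnW.
    by rewrite /noise ffunE eqxx cind // leqnn ltnSn.
  rewrite ler_wpM2l ?expR_ge0 //.
  apply: (le_trans (coin_mgf _ _)); first exact: le_trans (cB n s _) (B4 n _).
  rewrite ler_expR ler_wpM2l // -(real_normK (num_real (c n s))).
  by rewrite ler_sqr ?nnegrE // ?cB //; apply: le_trans (cB n s _).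
rewrite Ex_mulr big_ord_recr /= expRD ler_wpM2r ?expR_ge0 //.
apply: IH.
- by move=> i j /andP[ij jn]; rewrite yinj // ij ltnW.
- by move=> i j s b /andP[ij jn]; rewrite cind // ij ltnW.
- by move=> j s jn; rewrite cB // ltnW.
- by move=> j jn; rewrite B4 // ltnW.
Qed.

Lemma independent_mgf (c : T -> R) : (forall y, `|c y| <= 1 / 4) ->
  Ex (fun s => expR (\sum_y noise s y * c y)) <= expR (\sum_y 8 * c y ^+ 2).
Proof.
move=> c4; rewrite /Ex.
have -> : \sum_s weight s * expR (\sum_y noise s y * c y) =
    \prod_y \sum_b coin y b * expR ((sgb b - f y) * c y).
  rewrite bigA_distr_bigA; apply: eq_bigr => s _.
  by rewrite expR_sum -big_split.
rewrite expR_sum; apply: ler_prod => y _.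
rewrite coin_mgf // andbT sumr_ge0 // => b _.
by rewrite mulr_ge0 ?coin_ge0 ?expR_ge0.
Qed.
End ProductMeasure.


(** * Trigonometric sums and elementary estimates *)

Section Trigonometry.
Import numFieldNormedType.Exports.
Variable R : realType.
Implicit Types (a t u : R).

Lemma sin_cos_telescope t a : 2 * (cos t * sin a) = sin (t + a) - sin (t - a).
Proof. by rewrite sinD sinB; ring. Qed.

Lemma cosD_half t a : cos (t - a) + cos (t + a) = 2 * (cos t * cos a).
Proof. by rewrite cosB cosD; ring. Qed.

Lemma sinM_cos t u : 2 * (sin t * sin u) = cos (t - u) - cos (t + u).
Proof. by rewrite cosB cosD; ring. Qed.

Lemma cosDnat2pi t n : cos (t + n%:R * (2 * pi)) = cos t.
Proof. by rewrite !mulr_natl (periodicn (@cosD2pi R)). Qed.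

Lemma sinDnat2pi t n : sin (t + n%:R * (2 * pi)) = sin t.
Proof. by rewrite !mulr_natl (periodicn (@sinD2pi R)). Qed.

(** Multiplied by [2 * sin a] with [a = n * pi / p], the sum telescopes over a whole period; [sin a]
    is nonzero because [0 < n < p]. *)
Lemma sum_cos_period (p n : nat) t :
  (0 < n < p)%N -> \sum_(y < p) cos (n%:R * y%:R * (2 * (pi / p%:R)) + t) = 0.
Proof.
move=> /andP[n0 np].
have p0 : (0 : R) < p%:R by rewrite ltr0n; lia.
pose a : R := n%:R * (pi / p%:R).
have sa : sin a != 0.
  rewrite gt_eqF // sin_gt0_pi // /a; apply/andP; split.
    by rewrite mulr_gt0 ?divr_gt0 ?pi_gt0 // ltr0n.
  rewrite mulrCA gtr_pMr ?pi_gt0 // ltr_pdivrMr // mul1r ltr_nat //.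
apply: (mulIf sa); apply: (@mulfI _ 2); first by rewrite pnatr_eq0.
rewrite mul0r mulr0 mulr_suml mulr_sumr.
rewrite (eq_bigr (fun y : 'I_p => sin (y.+1%:R * (2 * a) + (t - a))
   - sin (y%:R * (2 * a) + (t - a)))); last first.
  move=> y _; rewrite sin_cos_telescope /a -natr1; congr (sin _ - sin _); ring.
rewrite -(big_mkord xpredT (fun y => sin (y.+1%:R * (2 * a) + (t - a))
   - sin (y%:R * (2 * a) + (t - a)))) telescope_sumr //.
have -> : p%:R * (2 * a) + (t - a) = (t - a) + n%:R * (2 * pi).
  by rewrite /a; field; rewrite gt_eqF.
by rewrite sinDnat2pi mul0r add0r subrr.
Qed.

(** A product of sines splits into the frequencies [k - l] and [k + l]. Both are below [p] in
    absolute value and [k + l] is positive, so only a zero difference contributes. *)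
Lemma sin_orthogonal (p k l x : nat) : (0 < k)%N -> (k.*2 < p)%N ->
  (0 < l)%N -> (l.*2 < p)%N ->
  \sum_(y < p) sin (k%:R * y%:R * (2 * (pi / p%:R)))
     * sin (l%:R * (y + x)%:R * (2 * (pi / p%:R)))
  = if k == l then p%:R / 2 * cos (k%:R * x%:R * (2 * (pi / p%:R))) else 0 :> R.
Proof.
move=> k0 kp l0 lp; set w := (2 * (pi / p%:R) : R).
apply: (@mulfI _ 2); first by rewrite pnatr_eq0.
rewrite mulr_sumr.
rewrite (eq_bigr (fun y : 'I_p => cos ((k%:R - l%:R) * y%:R * w - l%:R * x%:R * w)
  - cos ((k + l)%:R * y%:R * w + l%:R * x%:R * w))); last first.
  move=> y _; rewrite sinM_cos !natrD; congr (cos _ - cos _); ring.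
rewrite sumrB sum_cos_period ?subr0; last by lia.
have [->|kl] := eqVneq k l.
  rewrite (eq_bigr (fun=> cos (l%:R * x%:R * w))); last first.
    by move=> y _; rewrite subrr !mul0r sub0r cosN.
  rewrite sumr_const card_ord -mulr_natl; by field.
rewrite /= mulr0; have [lk|lk] := ltnP l k.
  by rewrite -natrB ?sum_cos_period // ?(ltnW lk) //; lia.
have {kl}lk : (k < l)%N by lia.
rewrite (eq_bigr (fun y : 'I_p => cos ((l - k)%:R * y%:R * w + l%:R * x%:R * w))).
  by rewrite sum_cos_period //; lia.
move=> y _; rewrite -cosN natrB ?(ltnW lk) //; congr cos; ring.
Qed.

(** The mean value theorem gives [sin (u / 2) >= u / 2 * cos (u / 2)], hence
    [sin u >= u * cos (u / 2) ^+ 2], and [2 * cos (u / 2) ^+ 2 = 1 + cos u >= 1]. *)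
Lemma sin_ge_half u : 0 <= u <= pi / 2 -> u / 2 <= sin u.
Proof.
move=> /andP[u0 up].
have p2 := pi_gt0 R.
have [->|un0] := eqVneq u 0; first by rewrite mul0r sin0.
have {u0}u0 : 0 < u by rewrite lt_neqAle eq_sym un0.
have hu0 : 0 < u / 2 by lra.
have [|z] := @MVT R sin cos 0 (u / 2) hu0 (fun x _ => is_derive_sin x).
  by apply: continuous_subspaceT => x; exact: continuous_sin.
rewrite in_itv /= sin0 !subr0 => /andP[z0 zu] sz.
have cz : cos (u / 2) < cos z.
  by rewrite ltr_cos // in_itv /=; apply/andP; split; lra.
have cu : 0 <= cos (u / 2).
  by apply: cos_ge0_pihalf; apply/andP; split; lra.
have c2 : 1 <= 2 * cos (u / 2) ^+ 2.
  have := cos_mulr2n (u / 2).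
  have -> : u / 2 *+ 2 = u by rewrite -mulr_natr; field.
  have : 0 <= cos u by apply: cos_ge0_pihalf; apply/andP; split; lra.
  by rewrite mulr2n; lra.
have -> : sin u = 2 * (cos (u / 2) * sin (u / 2)).
  have := sin_mulr2n (u / 2).
  have -> : u / 2 *+ 2 = u by rewrite -mulr_natr; field.
  by move=> ->; rewrite mulr_natl.
rewrite sz.
have : 0 <= (cos z - cos (u / 2)) * cos (u / 2) * u.
  by rewrite !mulr_ge0 ?subr_ge0 // ltW.
have : 0 <= (2 * cos (u / 2) ^+ 2 - 1) * u by rewrite mulr_ge0 ?subr_ge0 // ltW.
rewrite expr2; nra.
Qed.

(** The frequencies run through the positive integers of the parity of [m], in steps of 2, so
    multiplication by [sin t] telescopes. The extra 1 for even [m] is the zero frequency. *)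
Lemma dirichlet_kernel (m : nat) t :
  (\sum_(i < uphalf m) 2 * cos ((m - i.*2)%:R * t) + (~~ odd m)%:R) * sin t
  = sin (m.+1%:R * t).
Proof.
rewrite mulrDl mulr_suml.
rewrite (eq_bigr (fun i : 'I_(uphalf m) =>
    - (sin ((m.+1%:R - 2 * i.+1%:R) * t) - sin ((m.+1%:R - 2 * i%:R) * t)))); last first.
  move=> i _; rewrite -mulrA sin_cos_telescope opprB natrB; last by have := ltn_ord i; lia.
  rewrite -!natr1 -muln2 natrM; congr (sin _ - sin _); ring.
rewrite sumrN -(big_mkord xpredT (fun i =>
    sin ((m.+1%:R - 2 * i.+1%:R) * t) - sin ((m.+1%:R - 2 * i%:R) * t))).
rewrite telescope_sumr // mulr0 subr0 opprB.
have -> : m.+1%:R - 2 * (uphalf m)%:R = (~~ odd m)%:R :> R.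
  apply/eqP; rewrite subr_eq -natrM -natrD eqr_nat; apply/eqP; lia.
by case: (odd m) => /=; rewrite ?mul0r ?mul1r ?sin0 ?subr0 ?addr0 ?subrK.
Qed.

Lemma harmonic_le (n : nat) : \sum_(i < n.+1) (i.+1%:R)^-1 <= 1 + ln n.+1%:R :> R.
Proof.
elim: n => [|n IH]; first by rewrite big_ord1 invr1 ln1 addr0.
rewrite big_ord_recr /=; apply: (le_trans (lerD IH (lexx _))).
have n0 : (0 : R) < n.+1%:R by rewrite ltr0n.
have n1 : (0 : R) < n.+2%:R by rewrite ltr0n.
rewrite -addrA lerD2l.
have : ln (n.+1%:R / n.+2%:R : R) <= - n.+2%:R^-1.
  have -> : n.+1%:R / n.+2%:R = 1 + - n.+2%:R^-1 :> R.
    have n2 := lt0r_neq0 n1; apply: (mulIf n2).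
    by rewrite divfK // mulrDl mulNr mulVf // mul1r -[n.+2%:R]natr1 addrK.
  apply: le_ln1Dx; rewrite ltrN2 invf_lt1 // ltr1n //.
by rewrite ln_div ?posrE // lerNr opprB -lerBrDl.
Qed.

(** * The alternating kernel and its lower bound *)

Section AlternatingKernel.
Variable m : nat.
Let p := m.*2.+1.
Let a : R := pi / p%:R.

Definition freq (i : nat) := (m - i.*2)%N.

(** The constant is half of the zero frequency for even [m]: two consecutive values then add up to
    the full Dirichlet kernel. *)
Definition altker (x : nat) : R :=
  \sum_(i < uphalf m) cos ((freq i)%:R * x%:R * (2 * a)) / cos ((freq i)%:R * a)
  + (~~ odd m)%:R / 2.

Lemma freq_gt0 (i : 'I_(uphalf m)) : (0 < freq i)%N.
Proof. rewrite /freq; have := ltn_ord i; lia. Qed.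

Lemma freq_lt i : ((freq i).*2 < p)%N.
Proof. rewrite /freq /p; lia. Qed.

Let p_gt0 : (0 : R) < p%:R.
Proof. by rewrite ltr0n. Qed.

Let a_gt0 : 0 < a.
Proof. by rewrite divr_gt0 ?pi_gt0. Qed.

Let pa : p%:R * a = pi.
Proof. by rewrite /a mulrC divfK // gt_eqF. Qed.

(** The angle is [pi / 2 - (2 i + 1 / 2) a], so its cosine is a sine of a small angle, to which
    [sin_ge_half] applies. The inverse cosines thus have a harmonic sum as majorant. *)
Lemma cos_freq_ge (i : 'I_(uphalf m)) :
  (i.+1)%:R / (2 * p%:R) <= cos ((freq i)%:R * a).
Proof.
have hi := ltn_ord i.
pose u := (4 * i%:R + 1) / 2 * a.
have -> : (freq i)%:R * a = pi / 2 - u.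
  rewrite -pa /u /freq natrB; last by lia.
  by rewrite /p -[m.*2.+1%:R]natr1 -!mul2n !natrM; field.
rewrite cosB cos_pihalf sin_pihalf mul0r add0r mul1r.
have i0 : (0 : R) <= i%:R by rewrite ler0n.
have u0 : 0 <= u by rewrite /u mulr_ge0 ?(ltW a_gt0) //; lra.
have up : u <= pi / 2.
  rewrite -pa /u mulrAC ler_pM2r ?invr_gt0 // ler_pM2r //.
  by rewrite -natrM natr1 ler_nat /p; lia.
apply: le_trans (sin_ge_half _); last by rewrite u0.
have ha : 2 / p%:R <= a by rewrite /a ler_wpM2r ?pi_ge2 // invr_ge0 ltW.
apply: (@le_trans _ _ ((4 * i%:R + 1) / 2 * (2 / p%:R) / 2)); last first.
  by rewrite /u ler_pM2r ?invr_gt0 // ler_wpM2l //; lra.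
have -> : (4 * i%:R + 1) / 2 * (2 / p%:R) / 2 = (4 * i%:R + 1) / (2 * p%:R) :> R.
  by field; rewrite gt_eqF.
rewrite ler_wpM2r ?invr_ge0 ?mulr_ge0 ?(ltW p_gt0) // -natr1; lra.
Qed.

Lemma cos_freq_gt0 (i : 'I_(uphalf m)) : 0 < cos ((freq i)%:R * a).
Proof.
apply: lt_le_trans (cos_freq_ge i); rewrite divr_gt0 ?ltr0n // mulr_gt0 //.
Qed.

(** Around the midpoint of [x] and [x.+1] the two cosines sum to a product with factor
    [cos ((freq i)%:R * a)], which cancels the denominator. *)
Lemma altker_step (x : nat) : altker x + altker x.+1 =
  \sum_(i < uphalf m) 2 * cos ((freq i)%:R * ((2 * x%:R + 1) * a)) + (~~ odd m)%:R.
Proof.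
rewrite /altker addrACA -big_split; congr (_ + _); last by field.
apply: eq_bigr => i _ /=.
rewrite -mulrDl; set k := (freq i)%:R : R.
have -> : k * x%:R * (2 * a) = k * ((2 * x%:R + 1) * a) - k * a by ring.
have -> : k * x.+1%:R * (2 * a) = k * ((2 * x%:R + 1) * a) + k * a.
  by rewrite -natr1; ring.
by rewrite cosD_half mulrA mulfK // gt_eqF ?cos_freq_gt0.
Qed.

(** The Dirichlet kernel is [sin (m.+1%:R * t) / sin t], and [m.+1%:R * t] equals
    [t / 2 + pi / 2 + x * pi], so the numerator is [(-1) ^+ x * cos (t / 2)]. *)
Lemma altker_step_ge0 (x : nat) : (x < m)%N -> 0 <= (-1) ^+ x * (altker x + altker x.+1).
Proof.
move=> xm; rewrite altker_step; set t := (2 * x%:R + 1) * a.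
have x0 : (0 : R) <= x%:R by rewrite ler0n.
have t0 : 0 < t by rewrite mulr_gt0 //; lra.
have tpi : t < pi.
  by rewrite -pa ltr_pM2r // -natrM natr1 ltr_nat /p; lia.
have st : 0 < sin t by rewrite sin_gt0_pi ?t0.
rewrite -(pmulr_lge0 _ st) -mulrA dirichlet_kernel.
have -> : m.+1%:R * t = (t / 2 + pi / 2) + pi *+ x.
  rewrite -[pi *+ x]mulr_natr /t.
  have -> : m.+1%:R = (p%:R + 1) / 2 :> R.
    by rewrite /p -!natr1 -mul2n natrM; field.
  have -> : (p%:R + 1) / 2 * ((2 * x%:R + 1) * a) =
     (2 * x%:R + 1) * a / 2 + (2 * x%:R + 1) / 2 * (p%:R * a) by field.
  by rewrite pa; field.
rewrite (alternatingn (@sinDpi R)) sinDpihalf mulrA -exprD addnn -mul2n exprM sqrrN expr1n expr1n mul1r.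
by rewrite cos_ge0_pihalf //; apply/andP; split; lra.
Qed.

Lemma altker_sym (x : nat) : (x <= p)%N -> altker (p - x) = altker x.
Proof.
move=> xp; rewrite /altker; congr (_ + _); apply: eq_bigr => i _; congr (_ / _).
rewrite -cosN -(cosDnat2pi _ (freq i)); congr cos.
rewrite (natrB _ xp) -pa; ring.
Qed.

(** By symmetry [altker m.+1 = altker m], so the value is half of the Dirichlet kernel at [t = pi],
    where every cosine equals [(-1) ^+ m]. *)
Lemma altker_mid : altker m = (-1) ^+ m * m.+1%:R / 2.
Proof.
have E : altker m + altker m.+1 = (-1) ^+ m * m.+1%:R.
  rewrite altker_step.
  have -> : (2 * m%:R + 1) * a = pi by rewrite -pa /p -[m.*2.+1%:R]natr1 -mul2n natrM.
  rewrite (eq_bigr (fun=> 2 * (-1) ^+ m)); last first.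
    move=> i _; rewrite (mulr_natl pi) -[pi *+ _]add0r (alternatingn (@cosDpi R)) cos0 mulr1.
    congr (_ * _); rewrite -signr_odd -[RHS]signr_odd; congr (_ ^+ nat_of_bool _).
    rewrite /freq; have := ltn_ord i; lia.
  rewrite sumr_const card_ord -mulr_natr -signr_odd.
  have -> : m.+1%:R = 2 * (uphalf m)%:R + (~~ odd m)%:R :> R.
    by rewrite -natrM -natrD; congr (_%:R); lia.
  by case: (odd m) => /=; ring.
have S : altker m.+1 = altker m.
  by rewrite -(@altker_sym m) /p; [congr altker; lia | lia].
by rewrite S in E; rewrite -E; field.
Qed.

(** By [altker_step_ge0] the signed values [(-1) ^+ x * altker x] can only grow as [x] descends from
    [m], where [altker_mid] gives the bound; symmetry covers [x > m]. *)
Lemma altker_ge (x : nat) : (x <= p)%N -> m.+1%:R / 2 <= `|altker x|.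
Proof.
wlog : x / (x <= m)%N => [H xp|xm _].
  have [xm|xm] := leqP x m; first exact: H.
  by rewrite -altker_sym // H ?leq_subr // /p; rewrite /p in xp; lia.
have U n : (n <= m)%N -> m.+1%:R / 2 <= (-1) ^+ (m - n) * altker (m - n).
  elim: n => [|n IH] nm.
    by rewrite subn0 altker_mid !mulrA -exprD addnn -mul2n exprM sqrrN !expr1n mul1r.
  apply: le_trans (IH (ltnW nm)) _.
  have := @altker_step_ge0 (m - n.+1) ltac:(lia).
  have -> : (m - n)%N = (m - n.+1).+1 by lia.
  by rewrite exprS; lra.
have := U (m - x)%N (leq_subr _ _); rewrite subKn // => h.
apply: (le_trans h); apply: (le_trans (ler_norm _)).
by rewrite normrM normrX normrN1 expr1n mul1r.
Qed.

End AlternatingKernel.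

End Trigonometry.


(** * Truncation and perturbation of correlations of periodic functions *)

Section Periodic.
Variables (R : realType) (p : nat).

Lemma sum_shift (G : nat -> R) (x : nat) : (forall y, G (y + p)%N = G y) ->
  \sum_(y < p) G (y + x)%N = \sum_(y < p) G y.
Proof.
move=> Gp; elim: x => [|x IH]; first by under eq_bigr do rewrite addn0.
rewrite -IH; apply: (addrI (G x)).
rewrite [RHS]addrC -[G x in RHS]Gp addnC.
transitivity (\sum_(y < p.+1) G (y + x)%N); last by rewrite big_ord_recr /= addnC.
by rewrite big_ord_recl /= add0n; congr (_ + _); apply: eq_bigr => y _; rewrite /bump addnS addSn.
Qed.

Lemma amgm (t u v : R) : 0 < t -> `|u * v| <= (t * u ^+ 2 + v ^+ 2 / t) / 2.
Proof.
move=> t0; have t1 := lt0r_neq0 t0.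
rewrite ler_norml; apply/andP; split.
  rewrite -subr_ge0.
  have -> : u * v - - ((t * u ^+ 2 + v ^+ 2 / t) / 2) = (t * u + v) ^+ 2 / (2 * t).
    by field.
  by rewrite divr_ge0 ?sqr_ge0 // mulr_ge0 // ltW.
rewrite -subr_ge0.
have -> : (t * u ^+ 2 + v ^+ 2 / t) / 2 - u * v = (t * u - v) ^+ 2 / (2 * t).
  by field.
by rewrite divr_ge0 ?sqr_ge0 // mulr_ge0 // ltW.
Qed.

Definition cut (M u : R) : R := if `|u| <= M then u else 0.

Lemma norm_cut_le M u : `|cut M u| <= `|u|.
Proof. by rewrite /cut; case: ifP => // _; rewrite normr0. Qed.

Lemma cut_le M u : 0 <= M -> `|cut M u| <= M.
Proof. by move=> M0; rewrite /cut; case: ifP => // _; rewrite normr0. Qed.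

Lemma cutN M u : cut M (- u) = - cut M u.
Proof. by rewrite /cut normrN; case: ifP => // _; rewrite oppr0. Qed.

(** For [|u| > M], [u ^+ 2] is at most [2 / mu ^+ 2 * expR (mu * |u|)], and half of the exponent
    [2 * mu * |u|] is at least [mu * M]. The right side is in a form that exponential moments can
    average. *)
Lemma cut_tail_le (M u mu : R) : 0 < mu ->
  (u - cut M u) ^+ 2 <=
    2 / mu ^+ 2 * (expR (- (mu * M)) * (expR (2 * mu * u) + expR (- (2 * mu) * u))).
Proof.
move=> mu0; rewrite /cut; case: ifP => uM.
  rewrite subrr expr0n /= mulr_ge0 ?divr_ge0 ?sqr_ge0 // mulr_ge0 ?expR_ge0 //.
  by rewrite addr_ge0 ?expR_ge0.
rewrite subr0 mulrAC ler_pdivlMr ?exprn_gt0 //.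
have {}uM : M < `|u| by rewrite ltNge uM.
have h1 : (mu * `|u|) ^+ 2 / 2 <= expR (mu * `|u|).
  have := @expR_ge1Dxn R (mu * `|u|) 1 (mulr_ge0 (ltW mu0) (normr_ge0 _)).
  rewrite (_ : 2`! = 2)%N //; lra.
have h2 : expR (mu * `|u|) <= expR (- (mu * M)) * expR (2 * mu * `|u|).
  by rewrite -expRD ler_expR; nra.
have h3 : expR (2 * mu * `|u|) <= expR (2 * mu * u) + expR (- (2 * mu) * u).
  case: (ger0P u) => _.
    by rewrite lerDl expR_ge0.
  by rewrite mulrN mulNr lerDr expR_ge0.
have h4 := expR_ge0 (- (mu * M)).
have : (mu * `|u|) ^+ 2 = u ^+ 2 * mu ^+ 2.
  by rewrite exprMn real_normK ?num_real // mulrC.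
nra.
Qed.

Lemma corr_perturb (f g : nat -> R) (t : R) (x : nat) : 0 < t ->
  (forall y, f (y + p)%N = f y) -> (forall y, g (y + p)%N = g y) ->
  (forall y, `|g y| <= `|f y|) ->
  `|\sum_(y < p) f y * f (y + x)%N - \sum_(y < p) g y * g (y + x)%N|
  <= t * (\sum_(y < p) (f y - g y) ^+ 2) + (\sum_(y < p) f y ^+ 2) / t.
Proof.
move=> t0 fp gp gf; rewrite -sumrB.
apply: (le_trans (ler_norm_sum _ _ _)).
have d2 := @sum_shift (fun y => (f y - g y) ^+ 2) x ltac:(by move=> y /=; rewrite fp gp).
have f2 := @sum_shift (fun y => f y ^+ 2) x ltac:(by move=> y /=; rewrite fp).
have -> : t * (\sum_(y < p) (f y - g y) ^+ 2) + (\sum_(y < p) f y ^+ 2) / t =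
  \sum_(y < p) ((t * (f y - g y) ^+ 2 + f (y + x)%N ^+ 2 / t) / 2
    + (t * (f (y + x)%N - g (y + x)%N) ^+ 2 + f y ^+ 2 / t) / 2).
  rewrite big_split /= -!mulr_suml !big_split /= -!mulr_suml -!mulr_sumr d2 f2.
  by field; exact: lt0r_neq0.
apply: ler_sum => y _.
(* Each product has one factor from [f - g]; weighted AM-GM then leaves only square sums, which are
   shift invariant. *)
have -> : f y * f (y + x)%N - g y * g (y + x)%N =
  (f y - g y) * f (y + x)%N + (f (y + x)%N - g (y + x)%N) * g y by ring.
apply: (le_trans (ler_normD _ _)); apply: lerD; first exact: amgm.
apply: (le_trans (amgm _ _ t0)).
rewrite ler_pM2r ?invr_gt0 // lerD2l ler_pM2r ?invr_gt0 //.
by rewrite -(real_normK (num_real (f y))) -(real_normK (num_real (g y))) lerXn2r ?nnegrE.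
Qed.

End Periodic.

(** * Random sine polynomials with the kernel as autocorrelation *)

Section RandomSigns.
Variables (R : realType) (m : nat).
Let p := m.*2.+1.
Let a : R := pi / p%:R.
Let h := uphalf m.

(** Normalized so that the factor [p%:R / 2] of [sin_orthogonal] turns it into half a coefficient of
    [altker]. *)
Definition ampsq (i : nat) : R := (p%:R * cos ((freq m i)%:R * a))^-1.

Definition signed_sum (e : {ffun 'I_h -> bool}) (y : nat) : R :=
  \sum_(i < h) sgb R (e i) * (Num.sqrt (ampsq i) * sin ((freq m i)%:R * y%:R * (2 * a))).

Let p_gt0 : (0 : R) < p%:R.
Proof. by rewrite ltr0n. Qed.

Lemma ampsq_gt0 (i : 'I_h) : 0 < ampsq i.
Proof. by rewrite invr_gt0 mulr_gt0 // cos_freq_gt0. Qed.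

Lemma ampsq_ge0 (i : 'I_h) : 0 <= ampsq i.
Proof. exact: ltW (ampsq_gt0 i). Qed.

Lemma ampsq_le (i : 'I_h) : ampsq i <= 2 * i.+1%:R^-1.
Proof.
have i0 : (0 : R) < i.+1%:R by rewrite ltr0n.
have -> : 2 * i.+1%:R^-1 = (i.+1%:R / 2)^-1 :> R by rewrite invfM invrK mulrC.
rewrite lef_pV2 ?posrE ?divr_gt0 // ?mulr_gt0 ?cos_freq_gt0 //.
have := cos_freq_ge R i; rewrite -/p -/a.
rewrite ler_pdivrMr ?mulr_gt0 // ler_pdivrMr //.
by move=> ii; apply: (le_trans ii); rewrite (mulrC 2) mulrA [cos _ * _]mulrC.
Qed.

Lemma sum_ampsq_le : (0 < m)%N -> \sum_(i < h) ampsq i <= 2 * (1 + ln p%:R).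
Proof.
move=> m_gt0; apply: (@le_trans _ _ (\sum_(i < h) 2 * i.+1%:R^-1)).
  by apply: ler_sum => i _; exact: ampsq_le.
rewrite -mulr_sumr ler_wpM2l //.
have h0 : (0 < h)%N by rewrite /h; lia.
have -> : h = h.-1.+1 by lia.
apply: (le_trans (harmonic_le R _)).
by rewrite lerD2l ler_ln ?posrE ?ltr0n // ler_nat /h /p; lia.
Qed.

Lemma freq_inj (i j : 'I_h) : (freq m i == freq m j) = (i == j).
Proof.
apply/eqP/eqP => [|-> //]; rewrite /freq => E; apply: val_inj => /=.
have := ltn_ord i; have := ltn_ord j; rewrite {1 2}/h => hj hi; lia.
Qed.

(** Orthogonality kills the cross terms and the signs are squared in the others, so the result is
    independent of [e]. *)
Lemma signed_sum_corr e (x : nat) :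
  \sum_(y < p) signed_sum e y * signed_sum e (y + x)
  = (altker R m x - (~~ odd m)%:R / 2) / 2.
Proof.
rewrite /altker addrK mulr_suml.
under eq_bigr do rewrite mulr_suml.
rewrite exchange_big /=; apply: eq_bigr => i _.
under eq_bigr do rewrite mulr_sumr.
rewrite exchange_big /= (bigD1 i) //= [X in _ + X]big1 ?addr0.
  pose S := sgb R (e i) * Num.sqrt (ampsq i).
  rewrite (eq_bigr (fun y : 'I_p => S ^+ 2 * (sin ((freq m i)%:R * y%:R * (2 * a)) *
     sin ((freq m i)%:R * (y + x)%:R * (2 * a))))); last first.
    by move=> y _; rewrite /S; ring.
  rewrite -mulr_sumr sin_orthogonal ?freq_gt0 ?freq_lt // eqxx.
  rewrite /S exprMn -(real_normK (num_real (sgb R (e i)))) norm_sgb expr1n mul1r.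
  rewrite sqr_sqrtr ?ampsq_ge0 // /ampsq -/p -/a.
  by field; rewrite !lt0r_neq0 ?cos_freq_gt0.
move=> j ji.
pose S := sgb R (e i) * Num.sqrt (ampsq i) * (sgb R (e j) * Num.sqrt (ampsq j)).
rewrite (eq_bigr (fun y : 'I_p => S * (sin ((freq m i)%:R * y%:R * (2 * a)) *
     sin ((freq m j)%:R * (y + x)%:R * (2 * a))))); last first.
  by move=> y _; rewrite /S; ring.
rewrite -mulr_sumr sin_orthogonal ?freq_gt0 ?freq_lt // freq_inj eq_sym (negPf ji).
by rewrite mulr0.
Qed.

Lemma signed_sum_corr_ge e (x : nat) : (x <= p)%N ->
  m%:R / 4 <= `|\sum_(y < p) signed_sum e y * signed_sum e (y + x)|.
Proof.
move=> xp; rewrite signed_sum_corr normrM (ger0_norm (_ : 0 <= 2^-1)) ?invr_ge0 //.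
have := altker_ge R xp.
have := lerB_dist (altker R m x) ((~~ odd m)%:R / 2).
have : `|(~~ odd m)%:R / 2 : R| <= 1 / 2.
  by case: (odd m) => /=; rewrite ?mul0r ?normr0 ?ger0_norm //; lra.
rewrite -[m.+1%:R]natr1; lra.
Qed.

Lemma signed_sum_sqr e :
  \sum_(y < p) signed_sum e y ^+ 2 = p%:R / 2 * \sum_(i < h) ampsq i.
Proof.
transitivity (\sum_(y < p) signed_sum e y * signed_sum e (y + 0)).
  by apply: eq_bigr => y _; rewrite addn0 expr2.
rewrite signed_sum_corr /altker addrK mulr_suml mulr_sumr; apply: eq_bigr => i _.
rewrite mulr0 mul0r cos0 /ampsq -/p -/a.
by field; rewrite !lt0r_neq0 ?cos_freq_gt0.
Qed.

Lemma signed_sum_periodic e y : signed_sum e (y + p) = signed_sum e y.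
Proof.
apply: eq_bigr => i _; do 2!congr (_ * _).
rewrite -[RHS](sinDnat2pi _ (freq m i)); congr sin.
by rewrite natrD /a; field; rewrite lt0r_neq0.
Qed.

Lemma signed_sum_odd e y : (y <= p)%N -> signed_sum e (p - y) = - signed_sum e y.
Proof.
move=> yp; rewrite /signed_sum -sumrN; apply: eq_bigr => i _; rewrite -!mulrN.
do 2!congr (_ * _).
rewrite -sinN -[RHS](sinDnat2pi _ (freq m i)); congr sin.
by rewrite (natrB _ yp) /a; field; rewrite lt0r_neq0.
Qed.

(** Uniform signs are the product measure of mean function 0. As [ampsq i <= 2], the bound on [t]
    keeps each coefficient below [1 / 4]. *)
Lemma signed_sum_mgf (t : R) y : `|t| <= 1 / 8 ->
  Ex (fun=> 0) (fun e => expR (t * signed_sum e y))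
    <= expR (8 * t ^+ 2 * \sum_(i < h) ampsq i).
Proof.
move=> t8.
pose c (i : 'I_h) := t * (Num.sqrt (ampsq i) * sin ((freq m i)%:R * y%:R * (2 * a))).
have cs i : c i ^+ 2 <= t ^+ 2 * ampsq i.
  rewrite /c !exprMn sqr_sqrtr ?ampsq_ge0 //; apply: ler_wpM2l; first exact: sqr_ge0.
  rewrite ger_pMr ?ampsq_gt0 //.
  by have := cos2Dsin2 ((freq m i)%:R * y%:R * (2 * a));
    have := sqr_ge0 (cos ((freq m i)%:R * y%:R * (2 * a))); lra.
have c4 i : `|c i| <= 1 / 4.
  rewrite -ler_sqr ?nnegrE ?divr_ge0 ?normr_ge0 // real_normK ?num_real //.
  apply: (le_trans (cs i)).
  have A2 : ampsq i <= 2.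
    apply: (le_trans (ampsq_le i)); rewrite ger_pMr // invf_le1 ?ltr0n //.
    by rewrite ler1n.
  have t2 : t ^+ 2 <= (1 / 8) ^+ 2.
    by rewrite -(real_normK (num_real t)) lerXn2r ?nnegrE ?divr_ge0.
  apply: (@le_trans _ _ ((1 / 8) ^+ 2 * 2)).
    by rewrite ler_pM ?sqr_ge0 // ampsq_ge0.
  by rewrite !expr2; lra.
have f0 (i : 'I_h) : `|(fun=> 0) i : R| <= 1 by rewrite normr0.
have -> : (fun e => expR (t * signed_sum e y)) =
   (fun e => expR (\sum_(i < h) noise (fun=> 0) e i * c i)).
  apply: funext => e; congr expR; rewrite mulr_sumr; apply: eq_bigr => i _.
  by rewrite /noise subr0 /c; ring.
apply: (le_trans (independent_mgf f0 c4)).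
rewrite ler_expR mulr_sumr; apply: ler_sum => i _.
by rewrite -mulrA ler_wpM2l.
Qed.

(** First moment method: [cut_tail_le] is averaged over the signs, using the exponential moments at
    [2 * mu] and [- (2 * mu)]. *)
Lemma exists_signs (mu M : R) : 0 < mu <= 1 / 16 ->
  exists e, \sum_(y < p) (signed_sum e y - cut M (signed_sum e y)) ^+ 2
    <= p%:R * (4 / mu ^+ 2 * expR (32 * mu ^+ 2 * (\sum_(i < h) ampsq i) - mu * M)).
Proof.
move=> /andP[mu0 mu16].
have mu8 : 2 * mu <= 1 / 8 by lra.
have mu2 : 0 <= 2 * mu by lra.
have f0 (i : 'I_h) : `|(fun=> 0) i : R| <= 1 by rewrite normr0.
apply: (Ex_exists f0); rewrite Ex_sum.
apply: (@le_trans _ _ (\sum_(y < p)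
    (4 / mu ^+ 2 * expR (32 * mu ^+ 2 * (\sum_(i < h) ampsq i) - mu * M)))); last first.
  by rewrite sumr_const card_ord (mulr_natl _ p) lexx.
apply: ler_sum => y _.
apply: (le_trans (Ex_le f0 (fun e => cut_tail_le M (signed_sum e y) mu0))).
pose F b e := expR ((if b then 2 * mu else - (2 * mu)) * signed_sum e y).
have -> : (fun e => 2 / mu ^+ 2 * (expR (- (mu * M)) *
    (expR (2 * mu * signed_sum e y) + expR (- (2 * mu) * signed_sum e y)))) =
  (fun e => (\sum_(b <- [:: true; false]) F b e) * (2 / mu ^+ 2 * expR (- (mu * M)))).
  by apply: funext => e; rewrite !big_cons big_nil /F /=; ring.
rewrite Ex_mulr Ex_sum !big_cons big_nil addr0 /F.
have hb (t : R) : t ^+ 2 = 4 * mu ^+ 2 -> `|t| <= 1 / 8 ->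
  Ex (fun=> 0) (fun e => expR (t * signed_sum e y))
    <= expR (32 * mu ^+ 2 * \sum_(i < h) ampsq i).
  move=> t2 t8; apply: (le_trans (signed_sum_mgf y t8)).
  by rewrite t2 ler_expR le_eqVlt; apply/orP; left; apply/eqP; ring.
have h1 : Ex (fun=> 0) (fun e => expR (2 * mu * signed_sum e y))
    <= expR (32 * mu ^+ 2 * \sum_(i < h) ampsq i).
  by apply: hb; [ring | rewrite ger0_norm].
have h2 : Ex (fun=> 0) (fun e => expR (- (2 * mu) * signed_sum e y))
    <= expR (32 * mu ^+ 2 * \sum_(i < h) ampsq i).
  by apply: hb; [ring | rewrite normrN ger0_norm].
apply: (le_trans (ler_wpM2r _ (lerD h1 h2))).
  by rewrite mulr_ge0 ?expR_ge0 // divr_ge0 // sqr_ge0.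
rewrite expRD le_eqVlt; apply/orP; left; apply/eqP; field.
by rewrite lt0r_neq0.
Qed.

End RandomSigns.


(** * A bounded function of mean zero with large autocorrelation everywhere *)

Section FlatFunction.
Variable R : realType.

Lemma expR1_lt3 : expR 1 < 3 :> R.
Proof.
have h : expR (1 / 6) <= 6 / 5 :> R.
  have -> : 6 / 5 = (1 + - (1 / 6))^-1 :> R by field.
  rewrite -[X in expR X]opprK expRN lef_pV2 ?posrE ?expR_gt0 ?expR_ge1Dx //; lra.
have -> : (1 : R) = (1 / 6) *+ 6 by rewrite -mulr_natr; field.
rewrite -mulr_natl expRM_natl.
apply: (@le_lt_trans _ _ ((6 / 5) ^+ 6)).
  by rewrite lerXn2r ?nnegrE ?expR_ge0 ?divr_ge0.
by rewrite !exprS expr0; lra.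
Qed.

(** With [r] the square root of [L], [ln L <= 2 * r], so [512 * ln L <= 1024 * r <= r * r]. *)
Lemma lnln_bounds (L : R) : 0 < L -> 1024 <= Num.sqrt L ->
  1 <= ln L /\ 512 * ln L <= L.
Proof.
move=> L0 rL; set r := Num.sqrt L in rL *.
have Lr : L = r * r by rewrite -expr2 sqr_sqrtr ?ltW.
have r0 : 0 < r by lra.
split.
  rewrite -(@expRK R 1) ler_ln ?posrE ?expR_gt0 //.
  by apply: (le_trans (ltW expR1_lt3)); rewrite Lr; nra.
have : ln L <= 2 * r.
  by rewrite Lr lnM ?posrE //; have := ln_sublinear r0; lra.
by rewrite Lr; nra.
Qed.

Lemma odd_sum_eq0 (p : nat) (F : nat -> R) : (forall y, F (y + p)%N = F y) ->
  (forall y, (y <= p)%N -> F (p - y)%N = - F y) -> \sum_(y < p) F y = 0.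
Proof.
move=> Fp Fo.
have : \sum_(y < p) F y = - \sum_(y < p) F y.
  rewrite -{2}(@sum_shift _ _ F 1 Fp) -sumrN (reindex_inj rev_ord_inj) /=.
  by apply: eq_bigr => y _; rewrite addn1 Fo.
by move=> E; lra.
Qed.

Lemma flat_function (m : nat) : let p := m.*2.+1 in let L := ln p%:R : R in
  0 < L -> 1024 <= Num.sqrt L -> exists F : nat -> R,
  [/\ forall y, `|F y| <= 1, forall y, F (y + p)%N = F y, \sum_(y < p) F y = 0 &
    forall x, (x <= p)%N ->
      p%:R / (32 * 131 ^+ 2 * (L * ln L)) <= `|\sum_(y < p) F y * F (y + x)%N| ].
Proof.
move=> p L L0 rL.
have p0 : (0 : R) < p%:R by rewrite ltr0n.
have L1M : 1024 * 1024 <= L.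
  by rewrite -[leRHS](sqr_sqrtr (ltW L0)) expr2 ler_pM.
have [l1 lL] := lnln_bounds L0 rL; set l := ln L in l1 lL *.
have pL : 1024 * 1024 <= p%:R :> R by apply: (le_trans L1M); rewrite ltW // ln_sublinear.
have m0 : (0 < m)%N.
  by case: (posnP m) => // m0; exfalso; move: pL; rewrite /p m0 double0; lra.
have l0 : 0 < l by lra.
pose mu := Num.sqrt (l / L).
have mu2 : mu ^+ 2 = l / L by rewrite sqr_sqrtr // ltW ?divr_gt0.
have mu0 : 0 < mu by rewrite sqrtr_gt0 divr_gt0.
have mu16 : mu <= 1 / 16.
  rewrite -ler_sqr ?nnegrE ?divr_ge0 ?(ltW mu0) // mu2 ler_pdivrMr // expr2; lra.
(* Since [mu ^+ 2 * L = l] and the squared amplitudes sum to at most [4 * L], the tail exponent is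
   at most [128 * l - 131 * l = - 3 * l], a gain of [L ^+ 3]. *)
pose M := 131 * mu * L.
have M0 : 0 < M by rewrite !mulr_gt0.
have M2 : M ^+ 2 = 131 ^+ 2 * (L * l).
  by rewrite /M !exprMn mu2; field; rewrite lt0r_neq0.
have muM : mu * M = 131 * l.
  have -> : mu * M = 131 * (mu ^+ 2 * L) by rewrite /M; ring.
  by rewrite mu2 divfK // lt0r_neq0.
have mu016 : 0 < mu <= 1 / 16 by rewrite mu0.
have [e He] := @exists_signs R m mu M mu016.
set f := signed_sum R e in He.
have V4 : \sum_(i < uphalf m) ampsq R m i <= 4 * L.
  by apply: (le_trans (sum_ampsq_le R m0)); rewrite -/p -/L; lra.
have {}He : \sum_(y < p) (f y - cut M (f y)) ^+ 2 <= 4 * p%:R / L ^+ 2.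
  apply: (le_trans He); rewrite -/p.
  have -> : 4 * p%:R / L ^+ 2 = p%:R * (4 / (l / L) * (l / L ^+ 3)).
    by field; rewrite !lt0r_neq0.
  rewrite ler_pM2l // mu2 ler_pM2l ?divr_gt0 //.
  apply: (@le_trans _ _ (expR (- (l *+ 3)))).
    rewrite ler_expR muM.
    have -> : 32 * (l / L) * \sum_(i < uphalf m) ampsq R m i =
      32 * l * ((\sum_(i < uphalf m) ampsq R m i) / L) by ring.
    have : (\sum_(i < uphalf m) ampsq R m i) / L <= 4 by rewrite ler_pdivrMr.
    by rewrite -[l *+ 3]mulr_natl; nra.
  rewrite expRN -mulr_natl expRM_natl lnK ?posrE //.
  by rewrite ler_pdivlMr ?exprn_gt0 // mulVf ?lt0r_neq0 ?exprn_gt0.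
have fp y : f (y + p)%N = f y by exact: signed_sum_periodic.
pose F y := cut M (f y).
have Fp y : F (y + p)%N = F y by rewrite /F fp.
have corrF x : (x <= p)%N -> p%:R / 32 <= `|\sum_(y < p) F y * F (y + x)%N|.
  move=> xp.
  (* The weight [32 * L] makes the two errors at most [p / 64] and [p / 16], against a main term
     [(p - 1) / 8]. *)
  have t0 : 0 < 32 * L by rewrite mulr_gt0.
  have := corr_perturb x t0 fp Fp (fun y => norm_cut_le M (f y)).
  have := @signed_sum_corr_ge R m e x xp; rewrite -/f -/p.
  rewrite signed_sum_sqr -/p.
  set A := \sum_(y < p) _; set B := \sum_(y < p) F _ * _; set S := \sum_(y < p) _ ^+ 2.
  have hS : 32 * L * S <= p%:R / 64.
    apply: (@le_trans _ _ (32 * L * (4 * p%:R / L ^+ 2))); first by rewrite ler_pM2l.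
    have -> : 32 * L * (4 * p%:R / L ^+ 2) = 128 * p%:R / L.
      by field; rewrite lt0r_neq0.
    by rewrite ler_pdivrMr //; nra.
  have hV : p%:R / 2 * (\sum_(i < uphalf m) ampsq R m i) / (32 * L) <= p%:R / 16.
    rewrite ler_pdivrMr //; nra.
  have -> : m%:R = (p%:R - 1) / 2 :> R.
    by rewrite /p -[m.*2.+1%:R]natr1 -mul2n natrM; field.
  have := lerB_dist A (A - B); rewrite opprB addrCA subrr addr0.
  lra.
exists (fun y => F y / M); split.
- move=> y; rewrite normrM [X in _ * X]ger0_norm ?invr_ge0 ?(ltW M0) //.
  by rewrite ler_pdivrMr // mul1r cut_le // ltW.
- by move=> y; rewrite Fp.
- rewrite -mulr_suml odd_sum_eq0 ?mul0r //.
  by move=> y yp; rewrite /F /f signed_sum_odd // cutN.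
- move=> x xp.
  rewrite (eq_bigr (fun y : 'I_p => F y * F (y + x)%N / M ^+ 2)); last first.
    by move=> y _; rewrite /= mulrACA -invfM -expr2.
  have Mi : `|(M ^+ 2)^-1| = (M ^+ 2)^-1 by rewrite ger0_norm ?invr_ge0 ?sqr_ge0.
  rewrite -mulr_suml normrM Mi M2 -[32 * _ * _]mulrA invfM [p%:R * _]mulrA.
  apply: ler_wpM2r; last exact: corrF.
  by rewrite invr_ge0 -M2 sqr_ge0.
Qed.

End FlatFunction.


(** * Random rounding to signs along arithmetic progressions *)

Section Rounding.
Variables (R : realType) (n : nat).
Hypothesis p_prime : prime n.+2.
Local Notation T := 'I_n.+2.

(** Primality enters here, through Euclid's lemma. *)
Lemma mulrn_injZp (x : T) i j : x != 0 -> (i < j < n.+2)%N -> x *+ i != x *+ j.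
Proof.
move=> x0 /andP[ij jp]; rewrite eq_sym -subr_eq0 -mulrnBr ?(ltnW ij) //.
rewrite Zp_mulrn -val_eqE /=.
rewrite -/(dvdn _ _) Euclid_dvdM // negb_or; apply/andP; split.
  by rewrite gtnNdvd ?ltn_ord // lt0n.
by rewrite gtnNdvd //; lia.
Qed.

Lemma sum_progression (G : T -> R) (x : T) : x != 0 ->
  \sum_y G y = \sum_(j < n.+2) G (x *+ j).
Proof.
move=> x0; rewrite (reindex_inj (h := fun j : T => x *+ j)) //.
move=> i j E; apply/val_inj/eqP => /=; case: ltngtP => // ij.
  by have := @mulrn_injZp x i j x0; rewrite E eqxx ij ltn_ord => /(_ isT).
by have := @mulrn_injZp x j i x0; rewrite E eqxx ij ltn_ord => /(_ isT).
Qed.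

Variable F : T -> R.
Hypothesis F_le1 : forall y, `|F y| <= 1.

Definition corr (G : T -> R) (x : T) : R := \sum_y G y * G (y + x).

Definition signs (s : {ffun T -> bool}) (y : T) : R := sgb R (s y).

(** With [s = F + noise], the difference of products is [noise (y + x) * s y + noise y * F (y + x)];
    the first sum is then shifted by [x]. *)
Lemma corr_noise s x : corr (signs s) x - corr F x =
  \sum_y noise F s y * (signs s (y - x) + F (y + x)).
Proof.
under [RHS]eq_bigr do rewrite mulrDr.
rewrite big_split /= (reindex_inj (addIr x)) /= -big_split /corr -sumrB.
by apply: eq_bigr => y _; rewrite /= addrK /noise /signs; ring.
Qed.

(* Ordering the coordinates along 0, x, 2x, ... turns the correlation noise
   into a martingale, apart from the first term, which sees the last one. *)
Definition tracked (x : T) (s : {ffun T -> bool}) : R :=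
  if x == 0 then \sum_y noise F s y else
  \sum_(j < n.+1) noise F s (x *+ j.+1) * (signs s (x *+ j) + F (x *+ j.+2)).

Lemma norm_noise_le s y : `|noise F s y| <= 2.
Proof.
apply: (le_trans (ler_normB _ _)); rewrite norm_sgb.
by have := F_le1 y; lra.
Qed.

(** The 4 pays for the omitted term at [x *+ 0], a product of two factors of modulus at most 2. *)
Lemma corr_tracked s x : x != 0 ->
  `|corr (signs s) x - corr F x| <= `|tracked x s| + 4.
Proof.
move=> x0; rewrite corr_noise (sum_progression _ x0) big_ord_recl /= addrC.
apply: (le_trans (ler_normD _ _)); apply: lerD.
  rewrite /tracked (negPf x0) le_eqVlt; apply/orP; left; apply/eqP; congr `|_|.
  apply: eq_bigr => j _; rewrite /bump /= add1n.
  by rewrite [in X in signs s X]mulrSr addrK -[x *+ j.+1 + x]mulrSr.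
rewrite normrM.
have h1 := norm_noise_le s (x *+ 0).
have h2 : `|signs s (x *+ 0 - x) + F (x *+ 0 + x)| <= 2.
  apply: (le_trans (ler_normD _ _)); rewrite norm_sgb.
  by have := F_le1 (x *+ 0 + x); lra.
have -> : 4 = 2 * 2 :> R by ring.
by rewrite ler_pM.
Qed.

(** The coefficient of the noise at [x *+ j.+1] depends on [s] only at [x *+ j], which is not among
    the current or later points, and is at most [2 * |t|]; hence [8 * (2 * t) ^+ 2] per step. *)
Lemma tracked_mgf (t : R) x : `|t| <= 1 / 8 ->
  Ex F (fun s => expR (t * tracked x s)) <= expR (32 * t ^+ 2 * n.+2%:R).
Proof.
move=> t8; have [->|x0] := eqVneq x 0.
  have -> : (fun s => expR (t * tracked 0 s)) =
      (fun s => expR (\sum_y noise F s y * (fun=> t) y)).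
    by apply: funext => s; rewrite /tracked eqxx mulrC mulr_suml.
  apply: (le_trans (independent_mgf F_le1 _)).
    by move=> _; apply: (le_trans t8); lra.
  rewrite ler_expR sumr_const card_ord -[_ *+ n.+2]mulr_natr ler_pM2r ?ltr0n //.
  by have := sqr_ge0 t; lra.
pose c j s := t * (signs s (x *+ j) + F (x *+ j.+2)).
have -> : (fun s => expR (t * tracked x s)) =
    (fun s => expR (\sum_(j < n.+1) noise F s (x *+ j.+1) * c j s)).
  apply: funext => s; rewrite /tracked (negPf x0) mulr_sumr; congr expR.
  by apply: eq_bigr => j _; rewrite /c; ring.
apply: (le_trans (@martingale_mgf R T F F_le1 n.+1 (fun j => x *+ j.+1) c
  (fun=> 2 * `|t|) _ _ _ _)).
- by move=> i j ij; rewrite mulrn_injZp.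
- move=> i j s b ji; rewrite /c /signs ffunE.
  by rewrite (negPf (mulrn_injZp x0 _)) //; lia.
- move=> j s _; rewrite /c normrM mulrC ler_wpM2r //.
  apply: (le_trans (ler_normD _ _)); rewrite norm_sgb.
  by have := F_le1 (x *+ j.+2); lra.
- by move=> j _; lra.
rewrite ler_expR sumr_const card_ord -[_ *+ n.+1]mulr_natr exprMn real_normK ?num_real //.
have -> : 8 * (2 ^+ 2 * t ^+ 2) = 32 * t ^+ 2 by ring.
by rewrite ler_wpM2l ?ler_nat // mulr_ge0 ?sqr_ge0.
Qed.

(** A union bound: the sum [G] of the exponentials of both signs over all [x] has small mean, and it
    dominates each term. The slot [x = 0] controls the sum of the signs, hence the size of the
    set. *)
Lemma rounding (lam : R) : 0 < lam <= 1 / 8 -> exists s, forall x,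
  `|tracked x s| <= (ln (2 * n.+2%:R) + 32 * lam ^+ 2 * n.+2%:R) / lam.
Proof.
move=> /andP[l0 l8].
have l8' : `|lam| <= 1 / 8 by rewrite ger0_norm // ltW.
set E := 32 * lam ^+ 2 * n.+2%:R.
pose G s := \sum_x (expR (lam * tracked x s) + expR (- lam * tracked x s)).
have [s Gs] : exists s, G s <= 2 * n.+2%:R * expR E.
  apply: (Ex_exists F_le1).
  have -> : G = (fun s => \sum_x (\sum_(t <- [:: lam; - lam]) expR (t * tracked x s))).
    apply: funext => s; apply: eq_bigr => x _.
    by rewrite !big_cons big_nil addr0.
  rewrite Ex_sum.
  apply: (@le_trans _ _ (\sum_(x : T) 2 * expR E)).
    apply: ler_sum => x _; rewrite Ex_sum !big_cons big_nil addr0.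
    rewrite mulr2n mulrDl mul1r; apply: lerD.
      exact: tracked_mgf.
    by rewrite /E -[lam ^+ 2]sqrrN; apply: tracked_mgf; rewrite normrN.
  by rewrite sumr_const card_ord -[_ *+ n.+2]mulr_natr mulrAC.
have p0 : (0 : R) < 2 * n.+2%:R by rewrite mulr_gt0 ?ltr0n.
have h (t : R) x : expR (t * tracked x s) <= G s ->
    t * tracked x s <= ln (2 * n.+2%:R) + E.
  move=> tG; rewrite -ler_expR expRD lnK ?posrE //.
  exact: le_trans tG Gs.
exists s => x.
have e0 u : 0 <= expR u :> R := expR_ge0 u.
have Gx : expR (lam * tracked x s) + expR (- lam * tracked x s) <= G s.
  rewrite /G (bigD1 x) //= lerDl sumr_ge0 // => y _.
  by rewrite addr_ge0.
have h1 : lam * tracked x s <= ln (2 * n.+2%:R) + E.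
  by apply: h; apply: le_trans Gx; rewrite lerDl.
have h2 : - lam * tracked x s <= ln (2 * n.+2%:R) + E.
  by apply: h; apply: le_trans Gx; rewrite lerDr.
rewrite ler_pdivlMr // mulrC -[X in X * _](ger0_norm (ltW l0)) -normrM ler_norml.
by rewrite h1 andbT lerNl -mulNr.
Qed.

End Rounding.


(** * Translates of sets and correction of the cardinality *)

Section Translates.
Variable G : finZmodType.
Implicit Types (A B : {set G}) (x y : G).

Lemma mem_translate A x y : (y \in translate A x) = (y - x \in A).
Proof.
apply/imsetP/idP => [[a aA ->]|yA]; first by rewrite addrK.
by exists (y - x) => //; rewrite subrK.
Qed.

Lemma card_translate A x : #|translate A x| = #|A|.
Proof. by rewrite card_imset //; exact: addIr. Qed.

(** A point [y] gained by the larger intersection has [y] or [y - x] in [B :\: A]. *)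
Lemma card_selfmeet_sub A B x : A \subset B ->
  (#|A :&: translate A x| <= #|B :&: translate B x|
    <= #|A :&: translate A x| + 2 * (#|B| - #|A|))%N.
Proof.
move=> AB; apply/andP; split.
  apply/subset_leq_card/setISS => //; exact: imsetS.
have BA : (#|B| - #|A| = #|B :\: A|)%N by rewrite cardsD (setIidPr AB).
rewrite BA mul2n -addnn -{2}(card_translate (B :\: A) x).
apply: (@leq_trans #|(A :&: translate A x) :|: ((B :\: A) :|: translate (B :\: A) x)|).
  apply/subset_leq_card/subsetP => y; rewrite !inE !mem_translate !inE.
  by case: (y \in A); case: (y - x \in A); case: (y \in B); case: (y - x \in B).
apply: (leq_trans (leq_card_setU _ _)); rewrite leq_add2l.
exact: leq_card_setU.
Qed.

Lemma exists_subset_card A k : (k <= #|A|)%N -> exists2 B : {set G}, B \subset A & #|B| = k.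
Proof.
move=> kA; exists [set y in take k (enum A)].
  by apply/subsetP => y; rewrite inE => /mem_take; rewrite mem_enum.
rewrite cardsE (card_uniqP _) ?take_uniq ?enum_uniq // size_takel // -cardE //.
Qed.

Lemma exists_resize (R : realType) A k : (k <= #|G|)%N -> exists2 B : {set G}, #|B| = k &
  forall x, `|#|B :&: translate B x|%:R - #|A :&: translate A x|%:R|
    <= 2 * `|#|A|%:R - k%:R| :> R.
Proof.
move=> kG; have [kA|/ltnW Ak] := leqP k #|A|.
  have [B BA Bk] := exists_subset_card kA; exists B => // x.
  have /andP[h1 h2] := card_selfmeet_sub x BA; rewrite Bk in h2.
  rewrite distrC !ger0_norm ?subr_ge0 ?ler_nat // -!natrB // -natrM ler_nat; lia.
have [B BA Bk] : exists2 B : {set G}, A \subset B & #|B| = k.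
  (* Enlarging [A] amounts to shrinking its complement. *)
  have [|B BA Bk] := @exists_subset_card (~: A) (#|G| - k)%N.
    by rewrite cardsCs setCK leq_sub2l.
  exists (~: B); first by rewrite -setCS setCK.
  by rewrite cardsCs setCK Bk subKn.
exists B => // x.
have /andP[h1 h2] := card_selfmeet_sub x BA; rewrite Bk in h2.
rewrite [X in _ <= 2 * X]distrC !ger0_norm ?subr_ge0 ?ler_nat //.
rewrite -!natrB // -natrM ler_nat; lia.
Qed.

End Translates.

(** * Dictionary between sets and sign functions *)

Section SignsOfSet.
Variables (R : realType) (n : nat).
Local Notation T := 'I_n.+2.

Definition plus_set (s : {ffun T -> bool}) : {set T} := [set y | s y].

Lemma indicator_signs s y : (y \in plus_set s)%:R = (1 + signs R s y) / 2.
Proof. by rewrite inE /signs /sgb; case: (s y) => /=; field. Qed.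

Lemma card_sum_indicator (A : {set T}) : #|A|%:R = \sum_y (y \in A)%:R :> R.
Proof. by rewrite -sum1_card natr_sum big_mkcond; apply: eq_bigr => y _; case: ifP. Qed.

Lemma card_plus_set s : #|plus_set s|%:R = (n.+2%:R + \sum_y signs R s y) / 2.
Proof.
rewrite card_sum_indicator; under eq_bigr do rewrite indicator_signs.
by rewrite -mulr_suml big_split /= sumr_const card_ord.
Qed.

Lemma card_selfmeet_plus_set s (x : T) :
  #|plus_set s :&: translate (plus_set s) x|%:R =
    n.+2%:R / 4 + (\sum_y signs R s y) / 2 + corr (signs R s) x / 4.
Proof.
rewrite card_sum_indicator.
rewrite (eq_bigr (fun y => (1 + signs R s y + signs R s (y - x) + signs R s y * signs R s (y - x)) / 4)).
  rewrite -mulr_suml !big_split /= sumr_const card_ord.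
  have -> : \sum_y signs R s (y - x) = \sum_y signs R s y.
    by rewrite (reindex_inj (addIr x)); apply: eq_bigr => y _; rewrite /= addrK.
  have -> : \sum_y signs R s y * signs R s (y - x) = corr (signs R s) x.
    rewrite (reindex_inj (addIr x)); apply: eq_bigr => y _ /=.
    by rewrite addrK mulrC.
  by field.
by move=> y _; rewrite in_setI mem_translate -mulnb natrM !indicator_signs; field.
Qed.

End SignsOfSet.


(** * Error bookkeeping, large and bounded primes *)

Section Assembly.
Variable R : realType.

(** The loss [7 / 4 * Q + 2] is made of [Q / 4 + 1] from rounding the correlation, [Q / 2] from the
    sum of the signs, and [Q + 1] from resizing to [m] elements. *)
Lemma selfmeet_of_flat (n m : nat) (F : 'I_n.+2 -> R) (del lam : R) :
  prime n.+2 -> n.+2 = m.*2.+1 ->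
  (forall y, `|F y| <= 1) -> \sum_y F y = 0 ->
  (forall x, del * n.+2%:R <= `|corr F x|) -> del <= 1 ->
  0 < lam <= 1 / 8 ->
  let Q := (ln (2 * n.+2%:R) + 32 * lam ^+ 2 * n.+2%:R) / lam in
  exists2 A : {set 'I_n.+2}, #|A| = m &
    forall x, del * n.+2%:R / 4 - 7 / 4 * Q - 2
      <= `|#|A :&: translate A x|%:R - n.+2%:R / 4|.
Proof.
move=> pp pm F1 F0 Fc del1 lam8 Q.
have [s hs] := rounding pp F1 lam8; rewrite -/Q in hs.
have S0 : `|\sum_y signs R s y| <= Q.
  have := hs 0; rewrite /tracked eqxx.
  suff -> : \sum_y noise F s y = \sum_y signs R s y by [].
  by rewrite /noise sumrB F0 subr0.
have cS x : del * n.+2%:R - Q - 4 <= `|corr (signs R s) x|.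
  have Q0 : 0 <= Q by apply: le_trans S0.
  (* At [x = 0] the correlation of signs is exactly [p], so [del <= 1] suffices. *)
  have [->|x0] := eqVneq x 0.
    have -> : corr (signs R s) 0 = n.+2%:R.
      rewrite /corr (eq_bigr (fun=> 1)) ?sumr_const ?card_ord // => y _.
      by rewrite addr0 /signs /sgb; case: (s y); ring.
    have p0 : (0 : R) <= n.+2%:R by rewrite ler0n.
    by rewrite ger0_norm //; nra.
  have h1 := corr_tracked pp F1 s x0; have h2 := hs x; have h3 := Fc x.
  have := lerB_dist (corr F x) (corr F x - corr (signs R s) x).
  by rewrite subKr distrC; lra.
have mG : (m <= #|'I_n.+2|)%N by rewrite card_ord pm; lia.
have [A Am hA] := @exists_resize _ R (plus_set s) m mG.
exists A => // x.
have := hA x; rewrite card_selfmeet_plus_set card_plus_set.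
have := cS x; move: S0.
have -> : m%:R = (n.+2%:R - 1) / 2 :> R.
  by rewrite pm -[m.*2.+1%:R]natr1 -mul2n natrM; field.
set S := \sum_y _; set p := n.+2%:R; set N := #|_|%:R; set C := corr _ _.
have -> : (p + S) / 2 - (p - 1) / 2 = (S + 1) / 2 by field.
have half (u : R) k : `|u / k.+1%:R| = `|u| / k.+1%:R.
  by rewrite normrM [X in _ * X]ger0_norm ?invr_ge0 ?ler0n.
rewrite half; set X := N - p / 4; set Y := N - (_ + _).
have : `|C| / 4 <= `|X| + `|Y| + `|S| / 2.
  rewrite -!half; have -> : C / 4 = X - Y - S / 2 by rewrite /X /Y; field.
  by apply: (le_trans (ler_normB _ _)); rewrite lerD2r ler_normB.
have := ler_normD S 1; rewrite normr1; lra.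
Qed.

(** For odd [p] the integer [4 * N - p] is odd, hence nonzero. *)
Lemma selfmeet_odd (p N : nat) : odd p -> 1 / 4 <= `|N%:R - p%:R / 4 : R|.
Proof.
move=> op.
have -> : N%:R - p%:R / 4 = ((4 * N)%:R - p%:R) / 4 :> R by rewrite natrM; field.
rewrite normrM [`|4^-1|]ger0_norm ?invr_ge0 // ler_pM2r ?invr_gt0 //.
have [h|h] := leqP p (4 * N)%N.
  by rewrite -natrB // ger0_norm ?ler0n // ler1n; lia.
by rewrite distrC -natrB ?(ltnW h) // ger0_norm ?ler0n // ler1n; lia.
Qed.

(** Here [x] stands for [ln (2 * p)]. The divisor 448 makes the quadratic part of the loss,
    [56 * lam * p], equal to [del * p / 8]; the rest is polynomial in [L] and absorbed by [p]. *)
Lemma error_terms_le (C L l p x : R) : 0 < C -> 1 <= L -> 0 < l <= L -> 0 < p ->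
  x <= 2 * L -> (32 * 784 * C ^+ 2 + 32 * C) * L ^+ 5 <= p ->
  let del := (C * (L * l))^-1 in let lam := del / 448 in
  del * p / 16 <= del * p / 4 - 7 / 4 * ((x + 32 * lam ^+ 2 * p) / lam) - 2.
Proof.
move=> C0 L1 /andP[l0 lL] p0 xL big /=.
set D := C * (L * l); set del := D^-1; set lam := del / 448.
have L0 : 0 < L by lra.
have D0 : 0 < D by rewrite !mulr_gt0.
have -> : 7 / 4 * ((x + 32 * lam ^+ 2 * p) / lam) = 784 * x * D + p / D / 8.
  by rewrite /lam /del; field; rewrite lt0r_neq0.
have -> : del * p = p / D by rewrite mulrC.
suff : 784 * x * D + 2 <= p / (16 * D).
  by rewrite invfM mulrA mulrAC; lra.
have DL : D <= C * L ^+ 2 by rewrite /D ler_pM2l // expr2 ler_pM2l.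
rewrite ler_pdivlMr ?mulr_gt0 //; apply: le_trans big.
apply: (@le_trans _ _ ((1568 * L * (C * L ^+ 2) + 2) * (16 * (C * L ^+ 2)))).
  have h1 : 784 * x * D <= 1568 * L * D by rewrite ler_pM2r //; lra.
  have h2 : 1568 * L * D <= 1568 * L * (C * L ^+ 2) by rewrite ler_pM2l // mulr_gt0.
  apply: (@le_trans _ _ ((1568 * L * (C * L ^+ 2) + 2) * (16 * D))).
    by rewrite ler_pM2r ?mulr_gt0 //; lra.
  by rewrite ler_pM2l; [rewrite ler_pM2l | rewrite addr_gt0 // !mulr_gt0 ?exprn_gt0].
have h : L ^+ 2 <= L ^+ 5 by rewrite ler_weXn2l.
have -> : (1568 * L * (C * L ^+ 2) + 2) * (16 * (C * L ^+ 2)) =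
  32 * 784 * C ^+ 2 * L ^+ 5 + 32 * C * L ^+ 2 by ring.
by rewrite [leRHS]mulrDl lerD2l ler_wpM2l // mulr_ge0 // ltW.
Qed.

(** Uses the Taylor term [L ^+ 6 / 720] of the exponential. *)
Lemma pow5_le_exp (K L : R) : 0 < L -> 720 * K <= L -> K * L ^+ 5 <= expR L.
Proof.
move=> L0 KL; have := @expR_ge1Dxn R L 5 (ltW L0).
rewrite (_ : 6`! = 720)%N // => h.
have : K * L ^+ 5 <= L ^+ 6 / 720.
  by rewrite ler_pdivlMr // mulrAC [K * _]mulrC [leRHS]exprS ler_pM2r ?exprn_gt0.
lra.
Qed.

Lemma periodic_modn (p : nat) (F : nat -> R) y : (forall y, F (y + p)%N = F y) ->
  F (y %% p)%N = F y.
Proof.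
move=> Fp; rewrite {2}(divn_eq y p) addnC.
by elim: (y %/ p)%N => [|k IH]; rewrite ?addn0 // mulSn addnCA addnC Fp.
Qed.

Lemma selfmeet_large (n m : nat) : let p := n.+2 in let L := ln p%:R : R in
  let C := 32 * 131 ^+ 2 : R in
  prime p -> p = m.*2.+1 ->
  1024 * 1024 + 720 * (32 * 784 * C ^+ 2 + 32 * C) <= L ->
  exists2 A : {set 'I_n.+2}, #|A| = m &
    forall x, p%:R / (C * (L * ln L)) / 16
      <= `|#|A :&: translate A x|%:R - p%:R / 4|.
Proof.
move=> p L C pp pm.
have C0 : 0 < C by rewrite mulr_gt0 // exprn_gt0.
have C1 : 1 <= C by rewrite /C expr2; lra.
set K' := 32 * 784 * C ^+ 2 + 32 * C => KL.
have K0 : 0 < K' by rewrite addr_gt0 // !mulr_gt0 ?exprn_gt0.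
have L1 : 1024 * 1024 <= L by lra.
have L0 : 0 < L by lra.
have rL : 1024 <= Num.sqrt L.
  by rewrite -ler_sqr ?nnegrE ?sqrtr_ge0 // sqr_sqrtr ?expr2 // ltW.
have [l1 lL] := lnln_bounds L0 rL.
have p0 : (0 : R) < p%:R by rewrite ltr0n.
have Lm : L = ln m.*2.+1%:R by rewrite /L pm.
have [F] : exists F : nat -> R,
  [/\ forall y, `|F y| <= 1, forall y, F (y + p)%N = F y, \sum_(y < p) F y = 0 &
    forall x, (x <= p)%N ->
      p%:R / (C * (L * ln L)) <= `|\sum_(y < p) F y * F (y + x)%N| ].
  have := @flat_function R m; rewrite /= -pm -/p -/L; exact.
case=> F1 Fp F0 Fc.
have del1 : (C * (L * ln L))^-1 <= 1.
  rewrite invf_le1 ?mulr_gt0 //; last by lra.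
  have LL : 1 <= L * ln L by nra.
  by nra.
have del0 : 0 < (C * (L * ln L))^-1.
  by rewrite invr_gt0 !mulr_gt0 //; lra.
set del := _^-1 in del1 del0.
have lam8 : 0 < del / 448 <= 1 / 8 by apply/andP; split; lra.
have Fc' (x : 'I_n.+2) : del * p%:R <= `|corr (fun y : 'I_n.+2 => F y) x|.
  rewrite mulrC; apply: (le_trans (Fc x (ltnW (ltn_ord x)))).
  rewrite le_eqVlt; apply/orP; left; apply/eqP; congr `|_|.
  by apply: eq_bigr => y _; rewrite /= periodic_modn.
have [A Am hA] := selfmeet_of_flat pp pm (fun y => F1 y) F0 Fc' del1 lam8.
exists A => // x; apply: le_trans (hA x).
rewrite -/del [p%:R * del]mulrC.
apply: error_terms_le => //.
- by lra.
- by apply/andP; split; lra.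
- rewrite lnM ?posrE // -/L; have : ln 2 <= L.
    by rewrite /L ler_ln ?posrE // ler_nat.
  by lra.
- rewrite -[leRHS]lnK ?posrE // -/L -/K'.
  by apply: pow5_le_exp => //; lra.
Qed.

End Assembly.

Theorem theorem1p7 (R : realType) :
  exists c : R, 0 < c /\
    forall p : nat, prime p -> (3 <= p)%N ->
      exists A : {set 'Z_p},
        #|A| = (p %/ 2)%N /\
        forall x : 'Z_p,
          `| #|A :&: translate A x|%:R - p%:R / 4%:R |
            >= c * p%:R / (ln p%:R * ln (ln p%:R)).
Proof.
pose C := 32 * 131 ^+ 2 : R.
(* The first summand serves [flat_function], the second [pow5_le_exp]. *)
pose K := 1024 * 1024 + 720 * (32 * 784 * C ^+ 2 + 32 * C).
have C0 : 0 < C by rewrite mulr_gt0 // exprn_gt0.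
(* As [e < 3], the iterated logarithm is positive from [p = 3] on. *)
have l3 : 1 < ln 3 :> R by rewrite -[ltLHS](@expRK R 1) ltr_ln ?posrE ?expR_gt0 // expR1_lt3.
have ll3 : 0 < ln (ln 3) :> R by rewrite ln_gt0.
have l30 : 0 < ln 3 :> R by lra.
pose c1 := (16 * C)^-1.
(* For [3 <= p <= expR K] this makes the required bound at most [1 / 4]. *)
pose c2 := ln 3 * ln (ln 3) / (4 * expR K).
have c10 : 0 < c1 by rewrite invr_gt0 mulr_gt0.
have c20 : 0 < c2 by rewrite divr_gt0 ?mulr_gt0 ?expR_gt0.
exists (Num.min c1 c2); split; first by rewrite lt_min c10.
move=> [|[|n]] // pp p3.
pose m := (n.+2 %/ 2)%N.
have pm : n.+2 = m.*2.+1.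
  have : odd n.+2 by case: (even_prime pp) p3 => [->|].
  by rewrite /m divn2 => o; rewrite -[LHS]odd_double_half o.
have pR0 : (0 : R) < n.+2%:R by rewrite ltr0n.
have L3 : ln 3 <= ln n.+2%:R :> R by rewrite ler_ln ?posrE // ler_nat.
have l3L : ln (ln 3) <= ln (ln n.+2%:R) :> R by rewrite ler_ln ?posrE //; lra.
have [KL|LK] := leP K (ln n.+2%:R).
  have [A Am hA] := selfmeet_large pp pm KL.
  exists A; split => // x; apply: le_trans (hA x); rewrite -/C.
  set Ll := ln _ * ln _.
  have Ll0 : 0 < Ll by rewrite mulr_gt0 //; lra.
  have -> : n.+2%:R / (C * Ll) / 16 = c1 * n.+2%:R / Ll.
    by rewrite /c1; field; rewrite !lt0r_neq0.
  by rewrite ler_pM2r ?invr_gt0 // ler_pM2r // ge_min lexx.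
(* For bounded [p] any set of the right size works, by parity. *)
have [|A _ Am] := @exists_subset_card _ [set: 'I_n.+2] m.
  by rewrite cardsT card_ord /m leq_div.
exists A; split => // x.
have op : odd n.+2 by rewrite pm /= odd_double.
apply: le_trans (selfmeet_odd R _ op).
have LL : ln 3 * ln (ln 3) <= ln n.+2%:R * ln (ln n.+2%:R) :> R.
  by rewrite ler_pM // ltW.
rewrite ler_pdivrMr; last by apply: lt_le_trans LL; rewrite mulr_gt0.
apply: (@le_trans _ _ (c2 * expR K)).
  apply: ler_pM.
  - by rewrite le_min !ltW.
  - exact: ler0n.
  - by rewrite ge_min lexx orbT.
  - by rewrite -[leLHS]lnK ?posrE // ler_expR ltW.
rewrite /c2; have := expR_gt0 K => e0.
have -> : ln 3 * ln (ln 3) / (4 * expR K) * expR K = 1 / 4 * (ln 3 * ln (ln 3)).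
  by field; rewrite lt0r_neq0.
by rewrite ler_pM2l ?divr_gt0.
Qed.
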